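(* Let $B$ be a barcode with $n^B\ge 2$ bars and total persistence $L^B>0$, and let $p_i=\ell_i/L^B$ for $i=1,\dots,n^B$. Then $$\sum_{i=1}^{n^B}p_i^2=\frac{1}{n^B}+\frac{n^B-1}{(n^B)^2}\,cv\mathrm{TSI}(B).$$
   Context: A barcode $B=\{[b_i,d_i)\}_{i=1}^{n^B}$ is a finite multiset of bars, each given by its pair of real endpoints $b_i\le d_i$ (zero-length bars are allowed); $n^B$ is the number of bars counted with multiplicity, $\ell_i=d_i-b_i\ge 0$ are the bar lengths (lifetimes), and $L^B=\sum_{i=1}^{n^B}\ell_i$ is the total persistence. The Topological Stability Index is the unbiased sample variance of the lifetimes: $\mathrm{TSI}(B)=\frac{1}{n^B-1}\sum_{i=1}^{n^B}\left(\ell_i-\frac{L^B}{n^B}\right)^2$ for $n^B\ge 2$, and $\mathrm{TSI}(B)=0$ if $n^B\le 1$. For $n^B\ge 1$ and $L^B>0$, the normalized Topological Stability Index is $cv\mathrm{TSI}(B)=\mathrm{TSI}(B)/(L^B/n^B)^2$. *)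

(* Defs.v *)
From HB Require Import structures.
From mathcomp Require Import all_boot all_order all_algebra.
From mathcomp Require Import finmap multiset reals.

Set Implicit Arguments.
Unset Strict Implicit.
Unset Printing Implicit Defensive.

Import Order.TTheory GRing.Theory Num.Theory.

Local Open Scope ring_scope.

(* A bar [b, d) is recorded by its pair of endpoints (b, d), not by the
   underlying half-open interval: distinct zero-length bars stay distinct. *)
Record barcode (R : realType) := Barcode {
  bars : {mset (R * R)%type}%mset;
  bars_le : forall x : R * R, x \in bars -> x.1 <= x.2
}.

Definition lifetime (R : realType) (x : R * R) : R := x.2 - x.1.

(* [bars B] coerces to the sequence of its elements, each repeated according
   to its multiplicity; [size] and the sums below thus count multiplicities. *)
Definition nbars (R : realType) (B : barcode R) : nat := size (bars B).

Definition total_persistence (R : realType) (B : barcode R) : R :=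
  \sum_(x <- bars B) lifetime x.

Definition mean_lifetime (R : realType) (B : barcode R) : R :=
  total_persistence B / (nbars B)%:R.

Definition TSI (R : realType) (B : barcode R) : R :=
  if (nbars B <= 1)%N then 0
  else ((nbars B)%:R - 1)^-1 *
       \sum_(x <- bars B) (lifetime x - mean_lifetime B) ^+ 2.

(* Meaningful only for nbars B >= 1 and total_persistence B > 0; otherwise the
   division by zero gives the junk value 0. *)
Definition cvTSI (R : realType) (B : barcode R) : R :=
  TSI B / mean_lifetime B ^+ 2.

Definition normalized_lifetime (R : realType) (B : barcode R) (x : R * R) : R :=
  lifetime x / total_persistence B.

(* Main.v *)
Require Import Defs.
From mathcomp Require Import all_boot all_order all_algebra.
From mathcomp Require Import finmap multiset reals.
From mathcomp Require Import ring.

Import Order.TTheory GRing.Theory Num.Theory.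

Local Open Scope ring_scope.

(** With [n] bars, total persistence [L] and [Q] the sum of the squared
    lifetimes, the left-hand side is [Q / L ^+ 2].  Expanding the squares in
    the sample variance (the computational formula for the variance,
    [sum_sqr_deviation]) gives [(n - 1) * TSI B = Q - L ^+ 2 / n]; dividing
    by [L ^+ 2] and solving for [Q / L ^+ 2] yields the identity. *)

(** The cross term of the expanded squares is [- 2 * S * (S / n)] and the
    constant terms add up to [n * (S / n) ^+ 2], where [S] is the sum of the
    [f x]; together they leave [- S ^+ 2 / n]. *)
Lemma sum_sqr_deviation (F : fieldType) (T : Type) (s : seq T) (f : T -> F) :
  (size s)%:R != 0 :> F ->
  \sum_(x <- s) (f x - (\sum_(y <- s) f y) / (size s)%:R) ^+ 2 =
    \sum_(x <- s) f x ^+ 2 - (\sum_(x <- s) f x) ^+ 2 / (size s)%:R.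
Proof.
move=> n_neq0; set S := \sum_(y <- s) f y; set m := S / _.
under eq_bigr => x _ do rewrite sqrrB -mulrnAl.
rewrite big_split sumrB /= -mulr_suml sumrMnl -/S.
rewrite big_const_seq count_predT iter_addr_0 -mulr_natr /m.
by field.
Qed.

Theorem proposition3p3 (R : realType) (B : barcode R)
    (hn : (2 <= nbars B)%N) (hL : 0 < total_persistence B) :
  \sum_(x <- bars B) normalized_lifetime B x ^+ 2 =
    1 / (nbars B)%:R + ((nbars B)%:R - 1) / (nbars B)%:R ^+ 2 * cvTSI B.
Proof.
have L_neq0 : total_persistence B != 0 by rewrite gt_eqF.
have n_neq0 : (nbars B)%:R != 0 :> R by rewrite pnatr_eq0 -lt0n ltnW.
have n1_neq0 : (nbars B)%:R - 1 != 0 :> R.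
  by rewrite subr_eq0 pnatr_eq1 gtn_eqF.
rewrite /cvTSI /TSI leqNgt hn /= (sum_sqr_deviation _ _ _ _ n_neq0).
rewrite -/(nbars B) -/(total_persistence B) /mean_lifetime.
under eq_bigr => x _ do rewrite /normalized_lifetime expr_div_n.
rewrite -mulr_suml.
by field; rewrite L_neq0 n_neq0.
Qed.
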